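(* Let $n\ge 0$ be an integer and let $X$ be a metric space of asymptotic dimension at most $n$. Then for every $\epsilon>0$ there is $\delta>0$ such that the following holds: for every simplicial complex $K$, every subset $A\subset X$, every $\delta$-partition of unity $f\colon X\to K$ and every function $g\colon A\to K^{(n)}$ with $g(a)=f(a)$ for all $a\in A$, there is a function $h\colon X\to K^{(n)}$ that is an $\epsilon$-partition of unity and a filler, i.e. $h|_A=g$ and, for every $x\in X$ and every simplex $\Delta$ of $K$, $f(x)\in\Delta$ implies $h(x)\in\Delta$.
   Context: Simplicial complexes: for a set $S$, $\Delta(S)$ is the set of functions $p\colon S\to[0,1]$ with finite support and $\sum_{s\in S}p(s)=1$, with the metric inherited from $l^1(S)$, i.e. $d(p,q)=\|p-q\|_1=\sum_{s}|p(s)-q(s)|$. A simplicial complex $K$ is a subcomplex of $\Delta(S)$ for some set $S$ (a union of closed simplices $\{p\in\Delta(S): p(s)=0 \text{ for } s\notin T\}$, $T\subset S$ finite nonempty), with the induced metric. $K^{(0)}$ is its set of vertices, and $K^{(n)}$ is its $n$-skeleton (the points of $K$ whose support has at most $n+1$ elements), itself a simplicial complex. The star of a vertex $v\in K^{(0)}$ is $st(v)=\{p\in K: p(v)>0\}$. A function $f\colon X\to Y$ of metric spaces (not necessarily continuous) is $(\lambda,C)$-Lipschitz if $d_Y(f(x),f(y))\le\lambda\, d_X(x,y)+C$ for all $x,y\in X$. A family of subsets of $X$ is uniformly bounded if the diameters of its members have a common finite upper bound. The Lebesgue number of a cover $\mathcal U=\{U_s\}_{s\in S}$ of $X$ is $L(\mathcal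 U)=\inf_{x\in X}\sup_{s\in S}\mathrm{dist}(x,X\setminus U_s)$ (with $\mathrm{dist}(x,\emptyset)=\infty$). For $\delta>0$, a function $f\colon X\to K$ is a $\delta$-partition of unity if it is $(\delta,\delta)$-Lipschitz, the family $\mathcal V=\{f^{-1}(st(v))\}_{v\in K^{(0)}}$ is uniformly bounded, and the Lebesgue number of $\mathcal V$ is at least $\frac1\delta$. $X$ has asymptotic dimension at most $n$ if for every $R>0$ there is a uniformly bounded cover of $X$ with Lebesgue number at least $R$ such that every point of $X$ belongs to at most $n+1$ members of the cover. *)

(* Defs.v *)
From HB Require Import structures.
From mathcomp Require Import all_boot all_order all_algebra.
From mathcomp Require Import finmap.
From mathcomp Require Import all_classical all_reals.
From mathcomp Require Import ereal topology.

Set Implicit Arguments.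
Unset Strict Implicit.
Unset Printing Implicit Defensive.

Import Order.TTheory GRing.Theory Num.Theory.

Local Open Scope classical_set_scope.
Local Open Scope card_scope.
Local Open Scope ring_scope.

Section families_in_metric_spaces.
Context {R : realType} {X : metricType R}.
Implicit Types (A : set X) (x : X).

(* [diam set0] is [-oo] here, which is harmless for upper bounds. *)
Definition diam A : \bar R :=
  ereal_sup [set (mdist p.1 p.2)%:E | p in A `*` A].

(* [dist x set0] is [+oo]. *)
Definition dist x A : \bar R := ereal_inf [set (mdist x a)%:E | a in A].

(* A family of subsets of X is given by an index set [I : set T] and a map
   [U : T -> set X]; only the values of [U] on [I] count. *)
Definition uniformly_bounded {T : Type} (I : set T) (U : T -> set X) : Prop :=
  exists C : R, forall i, I i -> (diam (U i) <= C%:E)%E.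

Definition lebesgue_number {T : Type} (I : set T) (U : T -> set X) : \bar R :=
  ereal_inf [set ereal_sup [set dist x (~` U i) | i in I] | x in [set: X]].

End families_in_metric_spaces.

Definition asdim_le {R : realType} (X : metricType R) (n : nat) : Prop :=
  forall r : R, 0 < r -> exists U : set (set X),
    [/\ cover U id = [set: X],
        uniformly_bounded U id,
        (r%:E <= lebesgue_number U id)%E &
        forall x, [set A | U A /\ A x] #<= `I_n.+1].

Definition Lipschitz {R : realType} {X Y : metricType R} (l C : R)
    (f : X -> Y) : Prop :=
  forall x y, mdist (f x) (f y) <= l * mdist x y + C.

Definition supp {R : realType} {S : Type} (p : S -> R) : set S :=
  [set s | p s != 0].

Record Delta (R : realType) (S : choiceType) := MkDelta {
  Delta_val :> S -> R;
  Delta_itv01 : forall s, 0 <= Delta_val s <= 1;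
  Delta_finite : finite_set (supp Delta_val);
  Delta_sum1 : \sum_(s \in [set: S]) Delta_val s = 1 }.

Section Delta_metric.
Context {R : realType} {S : choiceType}.
Implicit Types p q r : Delta R S.

HB.instance Definition _ := gen_eqMixin (Delta R S).
HB.instance Definition _ := gen_choiceMixin (Delta R S).

Definition l1dist p q : R := \sum_(s \in [set: S]) `|p s - q s|.

Lemma Delta_ext p q : (forall s, p s = q s) -> p = q.
Proof.
case: p q => [p p1 p2 p3] [q q1 q2 q3] /= /funext pq; case: _ / pq in q1 q2 q3 *.
by congr MkDelta; exact: Prop_irrelevance.
Qed.

Lemma l1dist_fset p q (F : set S) : finite_set F ->
  supp p `<=` F -> supp q `<=` F ->
  l1dist p q = \sum_(s <- fset_set F) `|p s - q s|.
Proof.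
move=> finF pF qF; rewrite -fsbig_finite//= /l1dist; apply/esym/fsbig_widen => //.
move=> s [_ /= nFs].
have [p0 q0] : p s = 0 /\ q s = 0.
  by split; apply/eqP/negPn/negP; [move=> /pF|move=> /qF].
by rewrite p0 q0 subrr normr0.
Qed.

Lemma l1dist_xx p : l1dist p p = 0.
Proof. by rewrite /l1dist fsbig1// => s _; rewrite subrr normr0. Qed.

Lemma l1dist_eq0 p q : l1dist p q = 0 -> p = q.
Proof.
pose F := supp p `|` supp q.
have finF : finite_set F by rewrite finite_setU; split; apply: Delta_finite.
have pF : supp p `<=` F by left.
have qF : supp q `<=` F by right.
rewrite (l1dist_fset finF pF qF) => /eqP.
rewrite psumr_eq0 => [/allP h|s _]; last exact: normr_ge0.
apply: Delta_ext => s; have [Fs|nFs] := pselect (F s).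
  have := h s; rewrite in_fset_set// inE => /(_ Fs) /=.
  by rewrite normr_eq0 subr_eq0 => /eqP.
have -> : p s = 0 by apply/eqP/negPn/negP => /pF.
by apply/esym/eqP/negPn/negP => /qF.
Qed.

Lemma l1dist_sym p q : l1dist p q = l1dist q p.
Proof. by apply: eq_fsbigr => s _; rewrite distrC. Qed.

Lemma l1dist_triangle q p r : l1dist p r <= l1dist p q + l1dist q r.
Proof.
pose F := supp p `|` supp q `|` supp r.
have finF : finite_set F.
  by rewrite !finite_setU; do 2?split; exact: Delta_finite.
have pF : supp p `<=` F by left; left.
have qF : supp q `<=` F by left; right.
have rF : supp r `<=` F by right.
rewrite !(l1dist_fset finF)// -big_split/=; apply: ler_sum => s _.
exact: ler_distD.
Qed.

HB.instance Definition _ := isMetric.Build R (Delta R S)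
  l1dist_xx l1dist_eq0 l1dist_sym l1dist_triangle.

End Delta_metric.

Section complexes.
Context {R : realType} {S : choiceType}.
Implicit Types (T : set S) (K : set (Delta R S)).

Definition simplex T : set (Delta R S) :=
  [set p | forall s, ~ T s -> p s = 0].

Definition is_complex K : Prop := exists F : set (set S),
  (forall T, F T -> finite_set T /\ T !=set0) /\
  K = \bigcup_(T in F) simplex T.

Definition simplex_of K (D : set (Delta R S)) : Prop := exists T,
  [/\ finite_set T, T !=set0, D = simplex T & D `<=` K].

(* A vertex is identified with the element [v] of [S] whose closed simplex
   (a single point) lies in [K]. *)
Definition vertices K : set S := [set v | simplex [set v] `<=` K].

Definition skeleton (n : nat) K : set (Delta R S) :=
  [set p | K p /\ supp p #<= `I_n.+1].

Definition star K (v : S) : set (Delta R S) := [set p | K p /\ 0 < p v].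

Definition partition_of_unity {X : metricType R} (delta : R) K
    (f : X -> Delta R S) : Prop :=
  [/\ forall x, K (f x),
      Lipschitz delta delta f,
      uniformly_bounded (vertices K) (fun v => f @^-1` star K v) &
      ((delta^-1)%:E <=
        lebesgue_number (vertices K) (fun v => f @^-1` star K v))%E].

End complexes.

(* Main.v *)
(* Take a cover of X of multiplicity at most n+1 whose Lebesgue number exceeds
   a large r, and let f be so nearly constant at the scale of this cover that
   each member W lies in some f^-1(st v), v = v(W). Merging the W's with the
   same v(W) gives sets V_s indexed by vertices s, with truncated distance
   functions u_s(x) = min(1, dist(x, X \ V_s) / r); normalising them would
   prove the case A = set0. In general put t(x) = min(1, dist(x, A) / r), choose
   c(x) in A within r of x when t(x) < 1 (with c(x) = x on A), and normalise
     (1 - t(x)) min(f(x), f(c(x))) + t(x) u(x).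
   If W meets {t < 1}, take for v(W) a vertex at which f(c(x)) exceeds 1/(n+2),
   for some x in W with t(x) < 1: f o c is then positive at v(W) on all of W, so
   that where t < 1 the support lies in that of f(c(x)), while where t = 1 it
   consists of vertices v(W) with x in W. Both have at most n+1 elements.
   Continuity plays no role, so replacing f by f o c only costs an additive
   constant. *)
Require Import Defs.
From mathcomp Require Import all_boot all_order all_algebra.
From mathcomp Require Import finmap.
From mathcomp Require Import all_classical all_reals.
From mathcomp Require Import ereal topology.
From mathcomp Require Import ring lra.

Set Implicit Arguments.
Unset Strict Implicit.
Unset Printing Implicit Defensive.

Import Order.TTheory GRing.Theory Num.Theory.

Local Open Scope classical_set_scope.
Local Open Scope card_scope.
Local Open Scope ring_scope.

(** * Truncated distance to a set at scale [r] *)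

Section truncated_distance.
Context {R : realType} {X : metricType R}.
Variables (r : R) (r_gt0 : 0 < r).
Implicit Types (B : set X) (x y : X).

(* [min 1 (dist x B / r)], with value [1] when [B] is empty. *)
Definition tdist B x : R := inf ([set 1] `|` [set mdist x b / r | b in B]).

Lemma tdist_lb B x : lbound ([set 1] `|` [set mdist x b / r | b in B]) 0.
Proof. by move=> _ [->//|[b _ <-]]; rewrite divr_ge0 ?mdist_ge0// ltW. Qed.

Lemma tdist_ge0 B x : 0 <= tdist B x.
Proof. by apply: lb_le_inf; [exists 1; left|exact: tdist_lb]. Qed.

Lemma tdist_le1 B x : tdist B x <= 1.
Proof. by apply: ge_inf; [exists 0; exact: tdist_lb|left]. Qed.

Lemma tdist_le B x b : B b -> tdist B x <= mdist x b / r.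
Proof.
by move=> Bb; apply: ge_inf; [exists 0; exact: tdist_lb|right; exists b].
Qed.

Lemma tdist_in B x : B x -> tdist B x = 0.
Proof.
move=> Bx; apply/eqP; rewrite eq_le tdist_ge0 andbT.
by rewrite (le_trans (tdist_le _ Bx))// mdistxx mul0r.
Qed.

Lemma tdist_far B x : (forall b, B b -> r <= mdist x b) -> tdist B x = 1.
Proof.
move=> h; apply/eqP; rewrite eq_le tdist_le1/=; apply: lb_le_inf.
  by exists 1; left.
by move=> _ [->//|[b Bb <-]]; rewrite ler_pdivlMr// mul1r h.
Qed.

Lemma tdist_near B x : tdist B x < 1 -> exists2 b, B b & mdist x b < r.
Proof.
move=> h; apply: contrapT => nb; move: h; rewrite tdist_far ?ltxx// => b Bb.
by rewrite leNgt; apply/negP => xb; apply: nb; exists b.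
Qed.

Lemma tdist_lipschitz B x y : `|tdist B x - tdist B y| <= mdist x y / r.
Proof.
suff h u v : tdist B u - mdist u v / r <= tdist B v.
  have := h x y; have := h y x; rewrite (metric_sym y x) ler_norml.
  by move=> ? ?; apply/andP; split; lra.
apply: lb_le_inf; first by exists 1; left.
move=> _ [->|[b Bb <-]].
  rewrite lerBlDr (le_trans (tdist_le1 _ _))// lerDl.
  by rewrite divr_ge0 ?mdist_ge0// ltW.
rewrite lerBlDr (le_trans (tdist_le _ Bb))// -mulrDl ler_pM2r ?invr_gt0//.
by rewrite addrC metric_triangle.
Qed.

End truncated_distance.

(** * Pointwise inequalities for convex combinations and minima *)

Section estimates.
Context {R : realType}.

(** The change of weight multiplies [b - a], which is at most [a + b] in size. Summed over vertices,
    it is multiplied by the total masses at one point only. *)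
Lemma convex_comb_dist (t t' a a' b b' : R) :
  0 <= t' <= 1 -> 0 <= a -> 0 <= b ->
  `|((1 - t) * a + t * b) - ((1 - t') * a' + t' * b')| <=
    `|t - t'| * (a + b) + `|a - a'| + `|b - b'|.
Proof.
move=> /andP[t0 t1] a0 b0.
have -> : ((1 - t) * a + t * b) - ((1 - t') * a' + t' * b') =
    (t - t') * (b - a) + (1 - t') * (a - a') + t' * (b - b') by ring.
apply: le_trans (ler_normD _ _) _; apply: lerD; last first.
  by rewrite normrM (ger0_norm t0) ler_piMl.
apply: le_trans (ler_normD _ _) _; apply: lerD.
  rewrite normrM ler_wpM2l// ler_norml; apply/andP; split; lra.
by rewrite normrM ger0_norm ?ler_piMl//; lra.
Qed.

(** Each minimum lies within [|a - b|], respectively [|a' - b'|], of its first argument. In the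
    application [b] is the value at a displaced point, so these terms only add a constant. *)
Lemma min_dist (a b a' b' : R) :
  `|Num.min a b - Num.min a' b'| <= `|a - a'| + `|a - b| + `|a' - b'|.
Proof.
have h1 := ler_norm (a - a'); have h2 := ler_norm (a' - a).
have h3 := ler_norm (a - b); have h4 := ler_norm (b - a).
have h5 := ler_norm (a' - b'); have h6 := ler_norm (b' - a').
rewrite distrC in h2; rewrite distrC in h4; rewrite distrC in h6.
by rewrite ler_norml; case: (leP a b) => ab; case: (leP a' b') => ab';
  apply/andP; split; lra.
Qed.

Lemma min_ge (a b : R) : a - `|a - b| <= Num.min a b.
Proof.
have h3 := ler_norm (a - b); have h4 := normr_ge0 (a - b).
by case: (leP a b) => ab; lra.
Qed.

End estimates.

(** * Sums over finite supports and normalisation to points of [Delta R S] *)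

Section sums.
Context {R : realType} {S : choiceType}.
Implicit Types (p q : Delta R S) (P : set S).

(** At most [k] entries of [l] lie in [P], since [l] has no repetitions; the others contribute
    nothing positive. *)
Lemma sum_le_card (l : seq S) P (g : S -> R) (c : R) (k : nat) :
  uniq l -> P #<= `I_k -> 0 <= c -> (forall s, P s -> g s <= c) ->
  (forall s, ~ P s -> g s <= 0) -> \sum_(s <- l) g s <= k%:R * c.
Proof.
move=> ul Pk c0 gc g0.
apply: (@le_trans _ _ (\sum_(s <- l | `[< P s >]) c)).
  rewrite [leRHS]big_mkcond/=; apply: ler_sum => s _.
  by case: ifPn => [/asboolP/gc//|/asboolP/g0].
rewrite big_const_seq iter_addr addr0 -[leLHS]mulr_natl ler_wpM2r// ler_nat.
rewrite (leq_trans _ (geq_card_fset_set Pk))// -size_filter.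
apply: uniq_leq_size; first exact: filter_uniq.
move=> s; rewrite mem_filter => /andP[/asboolP Ps _].
rewrite in_fset_set ?inE//.
by apply: (card_le_finite Pk); exact: finite_II.
Qed.

Lemma sum_widen (g : S -> R) (P Q : set S) : finite_set P -> finite_set Q ->
  P `<=` Q -> (forall s, ~ P s -> g s = 0) ->
  \sum_(s <- fset_set Q) g s = \sum_(s <- fset_set P) g s.
Proof.
move=> fP fQ PQ g0; rewrite -!fsbig_finite//=; apply/esym/fsbig_widen => //.
by move=> s [_ /= /g0].
Qed.

Lemma sum_subset (A B : set S) (g : S -> R) : finite_set A -> finite_set B ->
  A `<=` B -> (forall s, 0 <= g s) ->
  \sum_(s <- fset_set A) g s <= \sum_(s <- fset_set B) g s.
Proof.
move=> fA fB AB g0.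
rewrite (big_fsetID _ (fun s => s \in fset_set A) (fset_set B))/=.
have -> : [fset x | x in fset_set B & x \in fset_set A]%fset = fset_set A.
  apply/fsetP => s; rewrite !inE/= andb_idl//.
  by rewrite !in_fset_set// !inE; exact: AB.
by rewrite lerDl sumr_ge0.
Qed.

Lemma sum_Delta_fset p (F : set S) : finite_set F -> supp p `<=` F ->
  \sum_(s <- fset_set F) p s = 1.
Proof.
move=> fF pF; rewrite -(Delta_sum1 p) -fsbig_finite//=.
apply: fsbig_widen => // s [_ /= nFs].
by apply/eqP/negPn/negP => /pF.
Qed.

Lemma sum_l1dist_ge (F : set S) p q : finite_set F ->
  \sum_(s <- fset_set F) `|p s - q s| <= l1dist p q.
Proof.
move=> fF; set G := F `|` (supp p `|` supp q).
have fG : finite_set G.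
  by rewrite !finite_setU; split=> //; split; exact: Delta_finite.
rewrite (@l1dist_fset _ _ p q G fG).
- by apply: sum_subset => //; left.
- by move=> s ps; right; left.
- by move=> s ps; right; right.
Qed.

Lemma coord_l1dist p q s : `|p s - q s| <= l1dist p q.
Proof.
have := @sum_l1dist_ge [set s] p q (finite_set1 _).
by rewrite fset_set1 big_seq_fset1.
Qed.

Lemma Delta_ge0 p s : 0 <= p s.
Proof. by case/andP: (Delta_itv01 p s). Qed.

Lemma suppP p s : supp p s <-> 0 < p s.
Proof. by rewrite lt_neqAle Delta_ge0 andbT eq_sym. Qed.

(** Were all coordinates at most [1/(n+2)], the at most [n+1] nonzero ones would sum to less than
    1. *)
Lemma big_coord p n : supp p #<= `I_n.+1 -> exists s, (n.+2%:R : R)^-1 < p s.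
Proof.
move=> pn; apply: contrapT => h.
have : \sum_(s <- fset_set (supp p)) p s <= n.+1%:R * n.+2%:R^-1.
  apply: (sum_le_card _ pn) => //.
  - by move=> s _; rewrite leNgt; apply/negP => ?; apply: h; exists s.
  - by move=> s /negP/negPn/eqP ->.
rewrite sum_Delta_fset//; last exact: Delta_finite.
rewrite ler_pdivlMr ?ltr0n// mul1r ler_nat ltnn//.
Qed.

Lemma normalize (w : S -> R) (F : set S) : finite_set F -> supp w `<=` F ->
  (forall s, 0 <= w s) -> 0 < \sum_(s <- fset_set F) w s ->
  exists p : Delta R S, forall s, p s = w s / \sum_(s <- fset_set F) w s.
Proof.
move=> fF wF w0; set N := \sum_(s <- _) _ => N0.
have wle s : w s <= N.
  have [Fs|nFs] := pselect (F s).
    rewrite /N (big_fsetD1 s)/=; last by rewrite in_fset_set// inE.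
    by rewrite lerDl sumr_ge0.
  suff -> : w s = 0 by rewrite ltW.
  by apply/eqP/negPn/negP => /wF.
have i01 s : 0 <= w s / N <= 1.
  by rewrite divr_ge0 ?(ltW N0)//= ler_pdivrMr// mul1r.
have sub : supp (fun s => w s / N) `<=` F.
  by move=> s; rewrite /supp/= mulf_eq0 negb_or => /andP[ws _]; exact: wF.
have s1 : \sum_(s \in [set: S]) (w s / N) = 1.
  rewrite -(@fsbig_widen _ _ _ _ F)//; last first.
    by move=> s [_ /= nFs]; apply/eqP/negPn/negP => /sub.
  by rewrite fsbig_finite//= -mulr_suml divff ?gt_eqF.
by exists (MkDelta i01 (sub_finite_set sub fF) s1).
Qed.

(** The difference splits into [(w - w') / N] and [(N' - N) / N] times [w' / N'], which has sum 1.
    Each part has l1-norm at most the sum of [|w - w'|] divided by [N], whence the factor 2. *)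
Lemma normalize_dist (w w' : S -> R) (l : seq S) (N N' : R) :
  (forall s, 0 <= w' s) -> N = \sum_(s <- l) w s -> N' = \sum_(s <- l) w' s ->
  0 < N -> 0 < N' ->
  \sum_(s <- l) `|w s / N - w' s / N'| <= 2 / N * \sum_(s <- l) `|w s - w' s|.
Proof.
move=> w0 NE NE' N0 N0'.
have h s : `|w s / N - w' s / N'| <=
    `|w s - w' s| / N + `|N' - N| / N * (w' s / N').
  have -> : w s / N - w' s / N' = (w s - w' s) / N + (N' - N) / N * (w' s / N').
    by field; rewrite !gt_eqF.
  rewrite (le_trans (ler_normD _ _))// !normrM !normfV (gtr0_norm N0).
  by rewrite (gtr0_norm N0') (ger0_norm (w0 s)).
apply: le_trans (ler_sum _ (fun s _ => h s)) _.
rewrite big_split/= -mulr_suml -mulr_sumr -mulr_suml -NE' divff ?gt_eqF// mulr1.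
have : `|N' - N| <= \sum_(s <- l) `|w s - w' s|.
  rewrite distrC NE NE' -sumrB; exact: ler_norm_sum.
rewrite -(ler_pM2r (_ : 0 < N^-1)) ?invr_gt0// => k.
by rewrite mulrAC [2 * _]mulr_natl mulr2n mulrDl lerD2l.
Qed.

End sums.

(** * Diameters and Lebesgue numbers in terms of points and balls *)

Section covers.
Context {R : realType} {X : metricType R}.

Lemma diam_leP (B : set X) (C : R) :
  (diam B <= C%:E)%E <-> forall x y, B x -> B y -> mdist x y <= C.
Proof.
split=> [h x y Bx By|h].
  rewrite -lee_fin; apply: le_trans h; apply: ereal_sup_ubound.
  by exists (x, y).
by apply: ge_ereal_sup => _ [[x y] [/= Bx By] <-]; rewrite lee_fin h.
Qed.

(** The strict inequality makes up for a supremum that may not be attained: a single member contains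
    the closed [r]-ball. *)
Lemma lebesgue_number_gt {T : Type} (I : set T) (U : T -> set X) (r : R) :
  (r%:E < lebesgue_number I U)%E ->
  forall x, exists2 i, I i & forall y, mdist x y <= r -> U i y.
Proof.
move=> h x.
have /ereal_sup_gt[_ [i Ii <-] rd] :
    (r%:E < ereal_sup [set dist x (~` U i) | i in I])%E.
  by apply: lt_le_trans h _; apply: ereal_inf_lbound; exists x.
exists i => // y; rewrite leNgt => /negP xy; apply: contrapT => Uy; apply: xy.
rewrite -lte_fin; apply: lt_le_trans rd _.
by apply: ereal_inf_lbound; exists y.
Qed.

Lemma lebesgue_number_ge {T : Type} (I : set T) (U : T -> set X) (r : R) :
  (forall x, exists2 i, I i & forall y, mdist x y < r -> U i y) ->
  (r%:E <= lebesgue_number I U)%E.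
Proof.
move=> h; apply: le_ereal_inf_tmp => _ [x _ <-]; have [i Ii iP] := h x.
apply: (@le_trans _ _ (dist x (~` U i))); last first.
  by apply: ereal_sup_ubound; exists i.
apply: le_ereal_inf_tmp => _ [y Uy <-]; rewrite lee_fin leNgt.
by apply/negP => /iP.
Qed.

End covers.

(** * Subcomplexes, supports and skeleta *)

Section complexes.
Context {R : realType} {S : choiceType}.
Implicit Types (K : set (Delta R S)) (p q : Delta R S).

Lemma in_simplex_supp (T : set S) p : simplex T p <-> supp p `<=` T.
Proof.
split=> [h s /eqP ps|h s Ts]; first by apply: contrapT => /h.
by apply/eqP/negPn/negP => /h.
Qed.

Lemma complex_carrier K p : is_complex K -> K p -> simplex (supp p) `<=` K.
Proof.
move=> [F [_ ->]] [T FT /in_simplex_supp pT] q /in_simplex_supp qp.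
by exists T => //; apply/in_simplex_supp; exact: subset_trans pT.
Qed.

Lemma complex_vertex n K p v : is_complex K -> K p -> 0 < p v ->
  vertices (skeleton n K) v.
Proof.
move=> cK Kp pv q /in_simplex_supp qv; split.
  apply: (complex_carrier cK Kp); apply/in_simplex_supp.
  by apply: (subset_trans qv) => _ ->; apply/suppP.
apply: card_le_trans (subset_card_le qv) _.
by rewrite (card_le_eql card_set1) card_le_II.
Qed.

Lemma vertices_skeleton n K : vertices (skeleton n K) `<=` vertices K.
Proof. by move=> v h p /h []. Qed.

(* On the n-skeleton some coordinate exceeds 1/(n+2), so a Lipschitz bound
   alone forces a large Lebesgue number. *)
Lemma skeleton_partition_of_unity {X : metricType R} (n : nat) K
    (delta epsilon l : R) (f h : X -> Delta R S) :
  is_complex K -> partition_of_unity delta K f ->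
  (forall x, supp (h x) `<=` supp (f x)) ->
  (forall x, supp (h x) #<= `I_n.+1) ->
  Lipschitz l l h -> 0 < epsilon -> 0 <= l <= epsilon ->
  l * (epsilon^-1 + 1) <= (n.+2%:R : R)^-1 ->
  partition_of_unity epsilon (skeleton n K) h.
Proof.
move=> cK [Kf _ [C fC] _] hf hn hl e0 /andP[l0 le] lk.
have Kh x : skeleton n K (h x).
  split=> //; apply: (complex_carrier cK (Kf x)).
  by apply/in_simplex_supp; exact: hf.
split=> //.
- move=> x y; apply: le_trans (hl x y) _.
  by rewrite lerD// ler_wpM2r// mdist_ge0.
(* Smaller supports give smaller preimages of stars, so the bound for [f] is inherited. *)
- exists C => v /vertices_skeleton/fC/diam_leP h1; apply/diam_leP.
  by move=> x y [_ /suppP/hf/suppP hx] [_ /suppP/hf/suppP hy]; apply: h1.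
- apply: lebesgue_number_ge => x; have [v vP] := big_coord (hn x).
  have v0 : 0 < h x v by apply: lt_trans vP; rewrite invr_gt0.
  exists v; first exact: complex_vertex cK (Kh x).1 v0.
  move=> y xy; split=> //.
  have /ler_normlP[_ h1] := coord_l1dist (h x) (h y) v.
  have h2 : l1dist (h x) (h y) <= l * mdist x y + l := hl x y.
  have h3 : l * mdist x y <= l * epsilon^-1 by rewrite ler_wpM2l// ltW.
  rewrite mulrDr mulr1 in lk; move: (n.+2%:R^-1 : R) lk vP => k lk vP; lra.
Qed.

End complexes.

(** * Construction of the filler *)

Section filler.
Context {R : realType} {S : choiceType} {X : metricType R}.

(** If [x] in [W] has [t x < 1], then for [y] in [W] both [y] and [c y] are within [2 * r + M] of
    [c x]. Over that distance [f] varies by at most [1/(n+2)], less than a large coordinate of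
    [f (c x)]. Otherwise a coordinate positive on the [M]-ball at a point of [W] suffices. *)
Lemma vertex_choice (n : nat) (r M delta : R) (f : X -> Delta R S)
    (t : X -> R) (c : X -> X) (W : set X) :
  0 <= delta -> Lipschitz delta delta f ->
  (forall x y, W x -> W y -> mdist x y <= M) ->
  (forall x, exists s, forall y, mdist x y <= M -> 0 < f y s) ->
  delta * (2 * r + M + 1) <= (n.+2%:R : R)^-1 ->
  (forall x, mdist x (c x) <= r) ->
  (forall x, t x < 1 -> supp (f (c x)) #<= `I_n.+1) ->
  W !=set0 ->
  exists s, forall y, W y -> 0 < f y s /\
    ((exists2 x, W x & t x < 1) -> 0 < f (c y) s).
Proof.
move=> d0 lf WM fM dn cr cn [x0 Wx0].
have [[x Wx tx]|nt] := pselect (exists2 x, W x & t x < 1); last first.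
  have [s sP] := fM x0; exists s => y Wy; split=> [|[x Wx tx]].
    by apply: sP; exact: WM.
  by exfalso; apply: nt; exists x.
have [s sP] := big_coord (cn _ tx); exists s.
have near z : mdist (c x) z <= 2 * r + M -> 0 < f z s.
  move=> cz; have /ler_normlP[_ h1] := coord_l1dist (f (c x)) (f z) s.
  have h2 : l1dist (f (c x)) (f z) <= delta * mdist (c x) z + delta := lf _ _.
  have h3 := ler_wpM2l d0 cz.
  move: (n.+2%:R^-1 : R) dn sP => k; rewrite !mulrDr in h3 *; lra.
move=> y Wy; have xy := WM x y Wx Wy.
have h1 := metric_triangle (c x) x y; have h2 := metric_triangle (c x) y (c y).
have h3 := cr x; have h4 := cr y; rewrite metric_sym in h3.
have r0 := le_trans (mdist_ge0 _ _) h4.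
by split=> [|_]; apply: near; lra.
Qed.

(** Inclusion of supports is the filler condition, since a closed simplex contains [f x] exactly
    when its vertex set contains the support. Both Lipschitz constants become small once [r] is
    large and [delta] is small compared with [1/r]. *)
Lemma Lipschitz_filler (n : nat) (r M delta : R) (U : set (set X)) (A : set X)
    (f : X -> Delta R S) :
  0 < r -> 0 <= M -> 0 <= delta -> Lipschitz delta delta f ->
  (forall x, exists2 W, U W & forall y, mdist x y <= r -> W y) ->
  (forall W, U W -> forall x y, W x -> W y -> mdist x y <= M) ->
  (forall x, [set W | U W /\ W x] #<= `I_n.+1) ->
  (forall x, exists s, forall y, mdist x y <= M -> 0 < f y s) ->
  (forall a, A a -> supp (f a) #<= `I_n.+1) ->
  delta * (2 * r + M + 1) <= (n.+2%:R : R)^-1 ->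
  exists h : X -> Delta R S,
    [/\ forall x, supp (h x) `<=` supp (f x),
        forall x, supp (h x) #<= `I_n.+1,
        forall a, A a -> h a = f a &
        Lipschitz (4 * ((3 * n + 4)%:R / r + delta))
                  (4 * (delta * (3 + 2 * r))) h].
Proof.
move=> r0 M0 d0 lf Ur UM Un fM An dn.
(* A point of [X] supplies [s0], the value of [v] on empty sets and on sets outside [U]. *)
have [X0|/existsNP[x0 _]] := pselect (forall x : X, False).
  by exists f; split=> // x; have := X0 x.
have [s0 _] := fM x0.
pose t := tdist r A.
have t01 x : 0 <= t x <= 1 by rewrite tdist_ge0 ?tdist_le1.
have [c cP] : {c : X -> X & forall x, mdist x (c x) <= r /\
    ((A x -> c x = x) /\ (t x < 1 -> A (c x)))}.
  apply: (@choice _ _ (fun x y => mdist x y <= r /\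
    ((A x -> y = x) /\ (t x < 1 -> A y)))) => x; have [Ax|nAx] := pselect (A x).
    by exists x; rewrite mdistxx ltW.
  have [tx|tx] := ltP (t x) 1; last by exists x; rewrite mdistxx ltW.
  by have [b Ab xb] := tdist_near r0 tx; exists b; rewrite ltW.
have cr x : mdist x (c x) <= r by case: (cP x).
have cn x : t x < 1 -> supp (f (c x)) #<= `I_n.+1.
  by case: (cP x) => _ [_ tA] /tA; exact: An.
have [v vP] : {v : set X -> S & forall W, U W -> W !=set0 ->
    forall y, W y -> 0 < f y (v W) /\
      ((exists2 x, W x & t x < 1) -> 0 < f (c y) (v W))}.
  apply: (@choice _ _ (fun W s => U W -> W !=set0 -> forall y, W y ->
    0 < f y s /\ ((exists2 x, W x & t x < 1) -> 0 < f (c y) s))) => W.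
  have [[UW W0]|nW] := pselect (U W /\ W !=set0); last first.
    by exists s0 => UW W0; exfalso; apply: nW.
  have [s sP] := vertex_choice d0 lf (UM W UW) fM dn cr cn W0.
  by exists s => _ _; exact: sP.
pose V s : set X := [set x | exists W, [/\ U W, W x & v W = s]].
(* If [V s] is all of [X], its complement is empty and [u x s] is 1. *)
pose u x s := tdist r (~` V s) x.
(* The minimum keeps the support inside that of [f x], as a filler requires, and inside that of
   [f (c x)], which is small where [t x < 1]. *)
pose m x s : R := Num.min (f x s) (f (c x) s).
pose w x s : R := (1 - t x) * m x s + t x * u x s.
have u0 x s : 0 <= u x s by exact: tdist_ge0.
have u1 x s : u x s <= 1 by exact: tdist_le1.
have m0 x s : 0 <= m x s by rewrite le_min !Delta_ge0.
have w0 x s : 0 <= w x s.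
  by case/andP: (t01 x) => ? ?; rewrite addr_ge0// mulr_ge0// subr_ge0.
have uV x s : ~ V s x -> u x s = 0 by exact: tdist_in.
have Vf x s : V s x -> 0 < f x s.
  by move=> [W [UW Wx <-]]; case: (vP W UW (ex_intro _ x Wx) x Wx).
have Vfc x s : V s x -> t x < 1 -> 0 < f (c x) s.
  move=> [W [UW Wx <-]] tx; case: (vP W UW (ex_intro _ x Wx) x Wx) => _; apply.
  by exists x.
(* Each such [s] is [v W] for a member [W] containing [x], so merging does not raise the
   multiplicity. *)
have Vn x : [set s | V s x] #<= `I_n.+1.
  apply: card_le_trans (Un x); apply: card_le_trans (card_image_le v _).
  by apply: subset_card_le => s [W [UW Wx <-]]; exists W.
have w_far x s : ~ supp (f x) s -> w x s = 0.
  move=> nfs; have fs0 : f x s = 0 by apply/eqP/negPn/negP.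
  have -> : w x s = (1 - t x) * m x s + t x * u x s by [].
  rewrite uV => [|/Vf]; last by rewrite fs0 ltxx.
  suff -> : m x s = 0 by rewrite !mulr0 addr0.
  by apply/eqP; rewrite eq_le m0 andbT ge_min fs0 lexx.
have sup_w x : supp (w x) `<=` supp (f x).
  move=> s; apply: contraPP => /w_far ws0.
  by rewrite /supp/= ws0 eqxx.
have ff x : finite_set (supp (f x)) by exact: Delta_finite.
pose N x := \sum_(s <- fset_set (supp (f x))) w x s.
have fc x : l1dist (f x) (f (c x)) <= delta * r + delta.
  apply: le_trans (lf _ _) _.
  by rewrite lerD2r ler_wpM2l.
(* [N x] is a convex combination of the masses of [m x] and [u x]. The first is at least 1 minus the
   distance from [f x] to [f (c x)], hence at least one half; the second is at least 1. *)
have N_ge x : 2^-1 <= N x.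
  have m_ge : 2^-1 <= \sum_(s <- fset_set (supp (f x))) m x s.
    have h1 : \sum_(s <- fset_set (supp (f x))) (f x s - `|f x s - f (c x) s|)
        <= \sum_(s <- fset_set (supp (f x))) m x s.
      by apply: ler_sum => s _; exact: min_ge.
    rewrite sumrB sum_Delta_fset// in h1.
    have h2 := sum_l1dist_ge (f x) (f (c x)) (ff x).
    have h3 : (n.+2%:R : R)^-1 <= 2^-1.
      by rewrite lef_pV2 ?posrE ?ltr0n// ler_nat.
    have h4 := fc x.
    have h5 : 0 <= delta * (r + M) by rewrite mulr_ge0// addr_ge0// ltW.
    move: (n.+2%:R^-1 : R) dn h3 => k; rewrite !mulrDr in h5 *; lra.
  have u_ge : 1 <= \sum_(s <- fset_set (supp (f x))) u x s.
    (* A member of [U] containing the [r]-ball at [x] makes the coordinate of [u x] at its vertex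
       equal to 1. *)
    have [W UW Wr] := Ur x.
    have Wx : W x by apply: Wr; rewrite mdistxx ltW.
    have us : u x (v W) = 1.
      apply: tdist_far => // b nb; rewrite leNgt; apply/negP => xb.
      by apply: nb; exists W; split=> //; apply: Wr; exact: ltW.
    rewrite -us (big_fsetD1 (v W))/=; last first.
      by rewrite in_fset_set// inE; apply/suppP/Vf; exists W.
    by rewrite lerDl sumr_ge0.
  rewrite /N /w big_split/= -!mulr_sumr.
  have /andP[t0 t1] := t01 x.
  have h1 : (1 - t x) * 2^-1 <=
      (1 - t x) * \sum_(s <- fset_set (supp (f x))) m x s.
    by rewrite ler_wpM2l// subr_ge0.
  have h2 := ler_wpM2l t0 u_ge.
  lra.
have N_gt0 x : 0 < N x by apply: lt_le_trans (N_ge x); rewrite invr_gt0.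
have [h hE] : {h : X -> Delta R S & forall x s, h x s = w x s / N x}.
  apply: (@choice _ _ (fun x (p : Delta R S) =>
    forall s, p s = w x s / N x)) => x.
  exact: (normalize (ff x) (sup_w x) (w0 x) (N_gt0 x)).
have sup_h x : supp (h x) `<=` supp (w x).
  by move=> s; rewrite /supp/= hE mulf_eq0 negb_or => /andP[].
exists h; split.
- by move=> x; apply: subset_trans (sup_w x).
- move=> x; have [tx|tx] := ltP (t x) 1.
    apply: card_le_trans (cn x tx).
    apply: subset_card_le => s /sup_h ws; apply/suppP.
    have [/Vfc|nV] := pselect (V s x); first exact.
    rewrite ltNge; apply/negP => fs0; move: ws.
    rewrite /supp/= /w uV// mulr0 addr0.
    suff -> : m x s = 0 by rewrite mulr0 eqxx.
    by apply/eqP; rewrite eq_le m0 andbT ge_min fs0 orbT.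
  apply: card_le_trans (Vn x); apply: subset_card_le => s /sup_h ws.
  apply: contrapT => nV; move: ws; rewrite /supp/= /w uV// mulr0 addr0.
  have -> : t x = 1 by apply/eqP; rewrite eq_le tx andbT; case/andP: (t01 x).
  by rewrite subrr mul0r eqxx.
- move=> a Aa; have wE s : w a s = f a s.
    rewrite /w /t tdist_in// subr0 mul1r mul0r addr0 /m.
    by case: (cP a) => _ [-> // _]; rewrite minxx.
  apply: Delta_ext => s; rewrite hE /N wE.
  by under eq_bigr do rewrite wE; rewrite sum_Delta_fset// divr1.
move=> x y; set F := supp (f x) `|` supp (f y).
have fF : finite_set F by rewrite finite_setU.
have xF : supp (f x) `<=` F by left.
have yF : supp (f y) `<=` F by right.
have NF z : supp (f z) `<=` F -> N z = \sum_(s <- fset_set F) w z s.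
  by move=> zF; rewrite (sum_widen (ff z) fF zF (w_far z)).
have d_r : 0 <= mdist x y / r by rewrite divr_ge0 ?mdist_ge0// ltW.
have uE z s : ~ V s z -> u z s <= 0 by move=> /uV ->.
have sum_u z : \sum_(s <- fset_set F) u z s <= n.+1%:R.
  rewrite -[leRHS]mulr1; by apply: (sum_le_card _ (Vn z)) => // s; exact: uE.
have sum_du : \sum_(s <- fset_set F) `|u x s - u y s| <=
    2 * (n.+1%:R * (mdist x y / r)).
  (* A vertex contributes only if [x] or [y] lies in [V s], so there are at most [2(n+1)] nonzero
     terms. *)
  pose g (z : X) (s : S) : R := if `[< V s z >] then mdist x y / r else 0.
  have gn z : \sum_(s <- fset_set F) g z s <= n.+1%:R * (mdist x y / r).
    apply: (sum_le_card _ (Vn z)) => // s; first by rewrite /g; case: ifP.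
    by rewrite /g; case: asboolP.
  have : \sum_(s <- fset_set F) `|u x s - u y s| <=
      \sum_(s <- fset_set F) (g x s + g y s).
    apply: ler_sum => s _; rewrite /g.
    have lu : `|u x s - u y s| <= mdist x y / r by exact: tdist_lipschitz.
    by case: asboolP => Vx; case: asboolP => Vy; [lra|lra|lra|];
      rewrite !uV// subrr normr0 addr0.
  rewrite big_split/=; have := gn x; have := gn y; lra.
have sum_m : \sum_(s <- fset_set F) m x s <= 1.
  rewrite -(sum_Delta_fset fF xF); apply: ler_sum => s _.
  by rewrite ge_min lexx.
(* Displacing [x] and [y] by [c] costs [delta * r + delta] each. *)
have sum_dm : \sum_(s <- fset_set F) `|m x s - m y s| <=
    delta * mdist x y + delta + 2 * (delta * r + delta).
  have : \sum_(s <- fset_set F) `|m x s - m y s| <=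
      \sum_(s <- fset_set F) (`|f x s - f y s| + `|f x s - f (c x) s| +
        `|f y s - f (c y) s|) by apply: ler_sum => s _; exact: min_dist.
  rewrite !big_split/=.
  have h1 : l1dist (f x) (f y) <= delta * mdist x y + delta := lf x y.
  have := sum_l1dist_ge (f x) (f y) fF.
  have := sum_l1dist_ge (f x) (f (c x)) fF.
  have := sum_l1dist_ge (f y) (f (c y)) fF.
  have := fc x; have := fc y; lra.
have sum_dw : \sum_(s <- fset_set F) `|w x s - w y s| <=
    (3 * n + 4)%:R / r * mdist x y + delta * mdist x y + delta * (3 + 2 * r).
  have : \sum_(s <- fset_set F) `|w x s - w y s| <= \sum_(s <- fset_set F)
     (`|t x - t y| * (m x s + u x s) + `|m x s - m y s| + `|u x s - u y s|).
    by apply: ler_sum => s _; exact: convex_comb_dist.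
  rewrite !big_split/= -mulr_sumr big_split/=.
  have : `|t x - t y| * (\sum_(s <- fset_set F) m x s +
      \sum_(s <- fset_set F) u x s) <= mdist x y / r * (1 + n.+1%:R).
    apply: ler_pM => //.
    - by rewrite addr_ge0// sumr_ge0.
    - exact: tdist_lipschitz.
    - by rewrite lerD.
  (* Here [3n+4] is [n+2], the bound on the mass of [m x + u x] that multiplies the change of [t],
     plus [2(n+1)] from the change of [u]. *)
  have -> : (3 * n + 4)%:R / r * mdist x y =
      mdist x y / r * (1 + n.+1%:R) + 2 * (n.+1%:R * (mdist x y / r)).
    by rewrite natrD natrM -[n.+1]addn1 natrD; ring.
  rewrite mulrDr; move: sum_dm sum_du; lra.
have -> : mdist (h x) (h y) =
    \sum_(s <- fset_set F) `|w x s / N x - w y s / N y|.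
  rewrite [LHS](l1dist_fset fF).
  - by apply: eq_bigr => s _; rewrite !hE.
  - by apply: subset_trans xF; apply: subset_trans (sup_w x).
  - by apply: subset_trans yF; apply: subset_trans (sup_w y).
apply: le_trans
  (normalize_dist (w0 y) (NF x xF) (NF y yF) (N_gt0 x) (N_gt0 y)) _.
(* The factor [2 / N x] is at most 4 because [N x] is at least one half. *)
apply: (@le_trans _ _ (4 * \sum_(s <- fset_set F) `|w x s - w y s|)).
  rewrite ler_wpM2r ?sumr_ge0// ler_pdivrMr//; have := N_ge x; lra.
by move: sum_dw; rewrite !mulrDl !mulrDr; lra.
Qed.

End filler.

(** * Choice of the constants and conclusion *)

Theorem theorem1p4 (R : realType) (n : nat) (X : metricType R)
    (asdimX : asdim_le X n) (epsilon : R) (epsilon_gt0 : 0 < epsilon) :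
  exists delta : R, 0 < delta /\
    forall (S : choiceType) (K : set (Delta R S)), is_complex K ->
    forall (A : set X) (f : X -> Delta R S), partition_of_unity delta K f ->
    forall g : A -> Delta R S,
      (forall a : A, skeleton n K (g a)) ->
      (forall a : A, g a = f (val a)) ->
    exists h : X -> Delta R S,
      [/\ partition_of_unity epsilon (skeleton n K) h,
          forall a : A, h (val a) = g a &
          forall (x : X) (D : set (Delta R S)),
            simplex_of K D -> D (f x) -> D (h x)].
Proof.
(* The Lipschitz constant sought for [h]: it makes [l * (1/epsilon + 1)] exactly [1/(n+2)] and is at
   most [epsilon]. *)
set l : R := epsilon / (n.+2%:R * (1 + epsilon)).
have e1 : 0 < 1 + epsilon by rewrite addr_gt0.
have l0 : 0 < l by rewrite divr_gt0// mulr_gt0// ltr0n.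
have l_e : l <= epsilon.
  rewrite ler_pdivrMr ?mulr_gt0 ?ltr0n// ler_peMr ?(ltW epsilon_gt0)//.
  by rewrite mulr_ege1 ?ler1n// lerDl ltW.
have l_inv : l * (epsilon^-1 + 1) <= (n.+2%:R : R)^-1.
  suff -> : l * (epsilon^-1 + 1) = (n.+2%:R : R)^-1 by [].
  have n2 : (n.+2%:R : R) != 0 by rewrite pnatr_eq0.
  rewrite /l; move: (n.+2%:R : R) n2 => k k0; field.
  by rewrite k0 !gt_eqF.
(* This makes [4 * (3 * n + 4) / r] equal to [l / 2]; the other half of the slope is left to
   [delta]. *)
pose r : R := 8 * (3 * n + 4)%:R / l.
have r0 : 0 < r by rewrite divr_gt0// mulr_gt0// ltr0n addn4.
(* Asking for [r + 1] makes the Lebesgue number strictly exceed [r]. *)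
have [U [_ [C UC] Ur Un]] := asdimX _ (addr_gt0 r0 ltr01).
(* [C] may be negative if [X] is empty. *)
pose M := Num.max 0 C.
have M0 : 0 <= M by rewrite le_max lexx.
(* With [delta = 1/D], the first summand gives [4 * delta <= l / 2] and the second bounds the
   additive constant by [l]. The third bounds the variation of [f] over distance [2 * r + M] by
   [1/(n+2)] and makes the Lebesgue number of the star preimages exceed [M]. *)
pose D : R := 8 / l + 4 * (3 + 2 * r) / l + n.+2%:R * (2 * r + M + 1).
have D1 : 0 < 8 / l by rewrite divr_gt0.
have D2 : 0 < 4 * (3 + 2 * r) / l.
  by rewrite divr_gt0// mulr_gt0// addr_gt0// mulr_gt0.
have D3 : M + 1 < n.+2%:R * (2 * r + M + 1).
  apply: (@lt_le_trans _ _ (2 * r + M + 1)); first lra.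
  by rewrite ler_peMl ?ler1n//; lra.
have D0 : 0 < D by rewrite /D; lra.
have dle (a b : R) : 0 < b -> a / b <= D -> D^-1 * a <= b.
  by move=> b0; rewrite ler_pdivrMr// ler_pdivrMl// mulrC.
exists D^-1; split=> [|S K cK A f fP g gn gf]; first by rewrite invr_gt0.
have [fK fL fC fLeb] := fP.
have [|||||||h [hf hn hA hL]] := @Lipschitz_filler R S X n r M D^-1 U A f
    r0 M0 _ fL.
- by rewrite invr_ge0 ltW.
- by apply: lebesgue_number_gt; apply: lt_le_trans Ur; rewrite lte_fin ltrDl.
- move=> W /UC/diam_leP WC x y Wx Wy.
  by rewrite le_max (WC _ _ Wx Wy) orbT.
- exact: Un.
- have MLeb : (M%:E <
      lebesgue_number (vertices K) (fun v => f @^-1` star K v))%E.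
    by apply: lt_le_trans fLeb; rewrite lte_fin invrK /D; lra.
  by move=> x; have [v _ vP] := lebesgue_number_gt MLeb x; exists v => y /vP[].
- by move=> a Aa; have [_] := gn (SigSub (mem_set Aa)); rewrite gf.
- apply: dle; first by rewrite invr_gt0 ltr0n.
  by rewrite invrK mulrC /D; lra.
exists h; split.
- apply: (skeleton_partition_of_unity cK fP hf hn _ epsilon_gt0 _ l_inv).
    move=> x y; apply: le_trans (hL x y) _; apply: lerD.
      rewrite ler_wpM2r ?mdist_ge0//.
      have -> : (3 * n + 4)%:R / r = l / 8.
        have : ((3 * n + 4)%:R : R) != 0 by rewrite pnatr_eq0 addn4.
        rewrite /r; move: ((3 * n + 4)%:R : R) => k k0; field.
        by rewrite k0 gt_eqF.
      have : D^-1 * 8 <= l by apply: dle => //; rewrite /D; lra.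
      lra.
    by rewrite mulrCA; apply: dle => //; rewrite /D; lra.
  by rewrite (ltW l0).
- by move=> a; rewrite hA ?gf//; exact/set_mem/valP.
- move=> x D' [T [_ _ -> _]] /in_simplex_supp fT.
  by apply/in_simplex_supp; apply: subset_trans fT.
Qed.
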